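(* Let $(G,o)$ be a Menger algebra of rank $n$ and let $H\subseteq G$ be a subset. The following conditions are equivalent: (i) $H$ is $l$-strong. (ii) For all $g_1,g_2\in G$ and $\overline{x},\overline{y}\in B$: if $g_1[\overline{x}]\in H$, $g_2[\overline{x}]\in H$ and $g_2[\overline{y}]\in H$, then $g_1[\overline{y}]\in H$. (iii) For all $\overline{x},\overline{y}\in B$: if $\eta^{\circ}_H\langle\overline{x}\rangle\cap\eta^{\circ}_H\langle\overline{y}\rangle\neq\varnothing$, then $\eta^{\circ}_H\langle\overline{x}\rangle=\eta^{\circ}_H\langle\overline{y}\rangle$.
   Context: Let $n$ be a positive integer. A Menger algebra $(G,o)$ of rank $n$ is a nonempty set $G$ with an $(n+1)$-ary operation $o:(f,g_1,\ldots,g_n)\mapsto f[g_1\ldots g_n]$ satisfying the superassociative law $f[g_1\ldots g_n][h_1\ldots h_n]=f[g_1[h_1\ldots h_n]\ldots g_n[h_1\ldots h_n]]$ for all $f,g_i,h_i\in G$. Put $B=G^n\cup\{\overline{e}\}$, where $\overline{e}=(e_1,\ldots,e_n)$ is a tuple of pairwise different formal symbols not in $G$. For $g\in G$ and $\overline{x}=(x_1,\ldots,x_n)\in G^n$ write $g[\overline{x}]=g[x_1\ldots x_n]$, and put $g[\overline{e}]=g$. For $H\subseteq G$, $g\in G$, $\overline{x}\in B$ put $\eta_H\langle g\rangle=\{\overline{x}\in B\mid g[\overline{x}]\in H\}$ and $\eta^{\circ}_H\langle\overline{x}\rangle=\{g\in G\mid g[\overline{x}]\in H\}$. The subset $H$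 is called $l$-strong if for all $a,b\in G$, $\eta_H\langle a\rangle\cap\eta_H\langle b\rangle\neq\varnothing$ implies $\eta_H\langle a\rangle=\eta_H\langle b\rangle$. *)

(* Defs.v *)
From mathcomp Require Import all_boot classical_sets.

Set Implicit Arguments.
Unset Strict Implicit.
Unset Printing Implicit Defensive.

Local Open Scope classical_set_scope.

(* Menger algebras of rank n: [mop f g] is f[g_1 ... g_n]. *)
Record mengerAlgebra (n : nat) := MengerAlgebra {
  mcarrier :> Type;
  mop : mcarrier -> n.-tuple mcarrier -> mcarrier;
  mcarrier_inhabited : inhabited mcarrier;
  superassociative : forall (f : mcarrier) (g h : n.-tuple mcarrier),
    mop (mop f g) h = mop f (map_tuple (fun gi => mop gi h) g)
}.

Section LStrong.
Variables (n : nat) (G : mengerAlgebra n).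
Implicit Types (H : set G) (g : G).

(* B = G^n together with the tuple of formal symbols (e_1, ..., e_n), which is
   only ever used as a whole: it is [None], and [Some x] is x in G^n. *)
Definition selectorTuple : Type := option (n.-tuple G).
Implicit Type x : selectorTuple.

(* g[x] for x in B, with g[e] = g. *)
Definition mact g x : G := if x is Some xs then mop g xs else g.

Definition eta H g : set selectorTuple := [set x | H (mact g x)].

Definition eta_circ H x : set G := [set g | H (mact g x)].

Definition l_strong H : Prop :=
  forall a b : G, eta H a `&` eta H b !=set0 -> eta H a = eta H b.

End LStrong.

(* Main.v *)
Require Import Defs.
From mathcomp Require Import all_boot classical_sets.

Local Open Scope classical_set_scope.

(** Relate [g] to [x] when [g[x]] lies in [H]. The sets [eta H g] are the rows of this relation and
    the sets [eta_circ H x] its columns. The middle condition says the relation is difunctional: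
    three corners of a rectangle force the fourth. This amounts to rows that meet being equal, and,
    being symmetric in rows and columns, equally to columns that meet being equal. *)

Theorem theorem3p4 (n : nat) (hn : (0 < n)%N) (G : mengerAlgebra n) (H : set G) :
  (l_strong H <->
   (forall (g1 g2 : G) (x y : selectorTuple G),
      H (mact g1 x) -> H (mact g2 x) -> H (mact g2 y) -> H (mact g1 y))) /\
  ((forall (g1 g2 : G) (x y : selectorTuple G),
      H (mact g1 x) -> H (mact g2 x) -> H (mact g2 y) -> H (mact g1 y)) <->
   (forall x y : selectorTuple G,
      eta_circ H x `&` eta_circ H y !=set0 -> eta_circ H x = eta_circ H y)).
Proof.
split; split.
- move=> strongH g1 g2 x y H1x H2x H2y.
  have eta12 : eta H g1 = eta H g2 by apply: strongH; exists x.
  by change (eta H g1 y); rewrite eta12.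
- move=> implH a b [x [Hax Hbx]].
  (* The shared [x] and the given [y] span the rectangle on rows [a] and [b]; exchanging [a] and [b]
     gives the other inclusion. *)
  by apply/seteqP; split=> y /= Hy; [apply: implH Hbx Hax Hy | apply: implH Hax Hbx Hy].
- move=> implH x y [g [Hgx Hgy]].
  (* Dually, the shared [g] serves as the second row for both inclusions. *)
  by apply/seteqP; split=> g1 /= Hg1; [apply: implH Hg1 Hgx Hgy | apply: implH Hg1 Hgy Hgx].
- move=> circH g1 g2 x y H1x H2x H2y.
  have circxy : eta_circ H x = eta_circ H y by apply: circH; exists g2.
  by change (eta_circ H y g1); rewrite -circxy.
Qed.
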